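(* Let $(a_n)_{n\ge 0}$ be the binary van der Corput sequence. For every integer $N\ge 1$ that is not of the form $4^m$ ($m$ a nonnegative integer), the graph obtained from the $N$-th sequence graph of $(a_n)$ by deleting the single edge $(N-1,0)$ of the cycle $C_1$ can be embedded into the Chamanara surface (drawn on it with no edge crossings).
   Context: The binary van der Corput sequence: if $n = \sum_{k=0}^{L-1} d_k(n) 2^k$ with $d_k(n)\in\{0,1\}$ is the binary expansion of $n$, then $a_n = \sum_{k=0}^{L-1} d_k(n)/2^{k+1}$; its terms are pairwise distinct. For a sequence $a_0,a_1,\dots$ of pairwise distinct reals and $N\ge1$, let $\pi$ be the permutation of $\{0,\dots,N-1\}$ with $a_{\pi(0)}<\dots<a_{\pi(N-1)}$. The $N$-th sequence graph is the 4-regular graph on $\{0,\dots,N-1\}$ whose edges are those of two Hamiltonian cycles: $C_1$ with edges $(0,1),(1,2),\dots,(N-2,N-1),(N-1,0)$, and $C_\pi$ with edges $(\pi(0),\pi(1)),\dots,(\pi(N-2),\pi(N-1)),(\pi(N-1),\pi(0))$. The Chamanara surface is obtained from the unit square $[0,1]^2$ by gluing boundary segments by translations: for each $k\ge1$, the top segment $[\sum_{j=1}^{k-1}2^{-j}, \sum_{j=1}^{k}2^{-j}]\times\{1\}$ is identified with the bottom segment $[2^{-k}, 2^{-k+1}]\times\{0\}$, and the right segment $\{1\}\times[\sum_{j=1}^{k-1}2^{-j}, \sum_{j=1}^{k}2^{-j}]$ is identified with the left segment $\{0\}\times[2^{-k},2^{-k+1}]$. *)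

(* Defs.v *)
From HB Require Import structures.
From Stdlib Require Import Relation_Operators Operators_Properties.
From mathcomp Require Import all_boot all_order all_algebra all_fingroup generic_quotient.
From mathcomp Require Import all_classical all_reals all_analysis.
Set Implicit Arguments.
Unset Strict Implicit.
Unset Printing Implicit Defensive.
Import Order.TTheory GRing.Theory Num.Theory.
Import numFieldNormedType.Exports.
Local Open Scope classical_set_scope.
Local Open Scope ring_scope.

(** * The binary van der Corput sequence *)

Definition bdigit (k n : nat) : nat := ((n %/ 2 ^ k) %% 2)%N.

(* [up_log 2 n.+1] is the least L such that n < 2 ^ L, i.e. the length of the
   binary expansion of n (0 when n = 0). *)
Definition vdc (R : realType) (n : nat) : R :=
  \sum_(k < up_log 2 n.+1) (bdigit k n)%:R / 2 ^+ k.+1.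

Lemma vdcE (R : realType) (L n : nat) : (n < 2 ^ L)%N ->
  vdc R n = \sum_(k < L) (bdigit k n)%:R / 2 ^+ k.+1.
Proof.
move=> nL; have uL : (up_log 2 n.+1 <= L)%N by rewrite up_log_min.
rewrite /vdc (big_ord_widen L (fun k => (bdigit k n)%:R / 2 ^+ k.+1)) //.
rewrite big_mkcond; apply: eq_bigr => k _; case: ifPn => //; rewrite -leqNgt => uk.
rewrite /bdigit divn_small ?mod0n ?mul0r//.
by apply: (@leq_trans (2 ^ up_log 2 n.+1)); rewrite ?up_logP// leq_exp2l.
Qed.

Lemma vdc_inj (R : realType) : injective (vdc R).
Proof.
pose V L n : R := \sum_(k < L) (bdigit k n)%:R / 2 ^+ k.+1.
have VS L n : V L.+1 n = ((n %% 2)%:R + V L (n %/ 2)%N) / 2.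
  rewrite /V big_ord_recl /= /bdigit expn0 divn1 expr1 mulrDl mulr_suml.
  congr (_ + _); apply: eq_bigr => k _ /=.
  by rewrite /bump /= add1n expnS divnMA [2 ^+ k.+2]exprSr invfM mulrA.
have V01 L n : 0 <= V L n < 1.
  elim: L n => [|L IH] n; first by rewrite /V big_ord0 lexx ltr01.
  rewrite VS; have /andP[V0 V1] := IH (n %/ 2)%N.
  rewrite divr_ge0 ?addr_ge0//= ltr_pdivrMr// mul1r.
  by rewrite (_ : 2 = 1 + 1)// ler_ltD// (ler_nat _ _ 1) -ltnS ltn_pmod.
have Vinj L n m : (n < 2 ^ L)%N -> (m < 2 ^ L)%N -> V L n = V L m -> n = m.
  elim: L n m => [|L IH] n m; first by rewrite expn0 !ltnS !leqn0 => /eqP-> /eqP->.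
  rewrite expnSr -!ltn_divLR// => nL mL.
  have two0 : (2 : R)^-1 != 0 by rewrite invr_eq0 pnatr_eq0.
  rewrite !VS => /(mulIf two0) E.
  have {}IH := IH _ _ nL mL.
  have /andP[n0 n1] := V01 L (n %/ 2)%N; have /andP[m0 m1] := V01 L (m %/ 2)%N.
  have rE : (n %% 2 = m %% 2)%N.
    move: E; rewrite !modn2; case: (odd n); case: (odd m) => //= E; exfalso.
    - by move: m1; rewrite -[V L (m %/ 2)%N]add0r -E ltNge lerDl n0.
    - by move: n1; rewrite -[V L (n %/ 2)%N]add0r E ltNge lerDl m0.
  move: E; rewrite rE => /addrI/IH qE.
  by rewrite (divn_eq n 2) (divn_eq m 2) qE rE.
move=> n m; rewrite (@vdcE R (maxn n m) n) ?(@vdcE R (maxn n m) m).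
- by apply: Vinj; rewrite (leq_ltn_trans _ (ltn_expl _ _))// ?leq_maxl ?leq_maxr.
- by rewrite (leq_ltn_trans _ (ltn_expl _ _))// leq_maxr.
- by rewrite (leq_ltn_trans _ (ltn_expl _ _))// leq_maxl.
Qed.

(** * Multigraphs and sequence graphs *)

(* Edges carry their own identity: for small N (e.g. N = 2 and N = 3) the two
   Hamiltonian cycles share edges, which then occur as parallel edges. *)
Record multigraph := Multigraph {
  vertex : finType;
  edge : finType;
  ends : edge -> vertex * vertex
}.

Definition delete_edge (G : multigraph) (e0 : edge G) : multigraph :=
  @Multigraph (vertex G) {e : edge G | e != e0} (fun e => ends (val e)).

Definition sorts_prefix (R : realType) (a : nat -> R) (N : nat)
    (p : {perm 'I_N}) : Prop :=
  forall i j : 'I_N, (i < j)%N -> a (p i) < a (p j).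

Lemma sorts_prefix_exists (R : realType) (a : nat -> R) (N : nat) :
  injective a -> exists p : {perm 'I_N}, sorts_prefix a p.
Proof.
move=> ainj; pose le := fun i j : 'I_N => a i <= a j.
pose s := sort le (enum 'I_N).
have sz : size s = N by rewrite size_sort size_enum_ord.
have us : uniq s by rewrite sort_uniq enum_uniq.
have letr : transitive le by move=> ? ? ?; exact: le_trans.
have ss : sorted le s by apply: sort_sorted => i j; exact: le_total.
have finj : injective (fun i : 'I_N => nth i s i).
  move=> i j /=; rewrite (set_nth_default j) ?sz// => /eqP.
  by rewrite nth_uniq ?sz// => /eqP/val_inj.
exists (perm finj) => i j ij; rewrite !permE lt_neqAle; apply/andP; split.
  apply/negP => /eqP/ainj/val_inj/finj ijE.
  by rewrite ijE ltnn in ij.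
rewrite (set_nth_default j) ?sz//.
by apply: (sorted_ltn_nth letr j ss); rewrite ?inE ?sz.
Qed.

(* [inl i] is the edge (i, i+1 mod N) of C_1 and [inr i] is the edge
   (p i, p (i+1 mod N)) of C_p. *)
Definition sequence_graph (N : nat) (p : {perm 'I_N}) : multigraph :=
  @Multigraph 'I_N ('I_N + 'I_N)%type
    (fun e => match e with
              | inl i => (i, ordS i)
              | inr i => (p i, p (ordS i))
              end).

Lemma pred_ltn (N : nat) : (0 < N)%N -> (N.-1 < N)%N.
Proof. by rewrite ltn_predL. Qed.

Definition C1_closing_edge (N : nat) (hN : (0 < N)%N) (p : {perm 'I_N}) :
    edge (sequence_graph p) :=
  inl (Ordinal (pred_ltn hN)).

(** * Crossing-free drawings *)

(* Drawings inside the subset S of T.  The simplicity clause allows the two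
   endpoints of an arc to coincide, which happens exactly for loops. *)
Definition embeds_in (R : realType) (G : multigraph) (T : topologicalType)
    (S : set T) : Prop :=
  exists (v : vertex G -> T) (arc : edge G -> R -> T),
    [/\ injective v /\ (forall x, S (v x)),
        forall e, [/\ {within `[0, 1]%classic, continuous (arc e)},
                      forall t, 0 <= t <= 1 -> S (arc e t),
                      arc e 0 = v (ends e).1 & arc e 1 = v (ends e).2],
        forall e s t, 0 <= s -> s < t -> t <= 1 -> arc e s = arc e t ->
          s = 0 /\ t = 1,
        forall e x t, 0 < t < 1 -> arc e t <> v x
      & forall e f s t, e <> f -> 0 < s < 1 -> 0 < t < 1 ->
          arc e s <> arc f t].

(** * The Chamanara surface *)

Section Chamanara.
Variable R : realType.

Definition unit_square : set (R * R) :=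
  [set z | 0 <= z.1 <= 1 /\ 0 <= z.2 <= 1].

(* The right end of the k-th top segment: 2^-1 + ... + 2^-k. *)
Definition seg_end (k : nat) : R := \sum_(1 <= j < k.+1) 2 ^- j.

(* The translation carrying [seg_end k.-1, seg_end k] onto [2^-k, 2^-(k-1)]
   maps x to y. *)
Definition seg_translate (k : nat) (x y : R) : Prop :=
  seg_end k.-1 <= x <= seg_end k /\ y = x - seg_end k.-1 + 2 ^- k.

Definition glued (z w : set_type unit_square) : Prop :=
  exists2 k : nat, (1 <= k)%N &
    [/\ (val z).2 = 1, (val w).2 = 0 & seg_translate k (val z).1 (val w).1] \/
    [/\ (val z).1 = 1, (val w).1 = 0 & seg_translate k (val z).2 (val w).2].

Definition chamanara_eqb : rel (set_type unit_square) :=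
  fun z w => `[< clos_refl_sym_trans _ glued z w >].

Lemma chamanara_eqb_equiv :
  equiv_class_of chamanara_eqb.
Proof.
split=> [z|z w|w z u].
- by apply/asboolP; apply: rst_refl.
- by apply/asboolP/asboolP; apply: rst_sym.
- by move=> /asboolP zw /asboolP wu; apply/asboolP; apply: rst_trans zw wu.
Qed.

Canonical chamanara_equiv : equiv_rel (set_type unit_square) :=
  EquivRelPack chamanara_eqb_equiv.

Definition chamanara_quotient : topologicalType :=
  quotient_topology {eq_quot chamanara_equiv}%qT.

(* Endpoints of the glued segments, together with the corners (0,0) and (1,1)
   at which the segments accumulate. *)
Definition square_vertices : set (R * R) :=
  [set z | z = (0, 0) \/ z = (1, 1) \/
           exists k : nat, [\/ z = (seg_end k, 1), z = (1, seg_end k),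
                               z = (2 ^- k, 0) | z = (0, 2 ^- k)]].

Definition chamanara_singular : set chamanara_quotient :=
  [set q | exists2 z : set_type unit_square,
             square_vertices (val z) & q = \pi_(chamanara_quotient)%qT z].

(* The quotient of the closed square is not a manifold at the (wild) singular
   points: the images of the vertices fall into classes that cannot be
   separated.  As usual for translation surfaces, they are not part of the
   surface. *)
Definition chamanara_surface : set chamanara_quotient :=
  ~` chamanara_singular.

End Chamanara.

(* Main.v *)
From Stdlib Require Import Relation_Operators Operators_Properties.
Require Import Defs.
From mathcomp Require Import all_boot all_order all_algebra all_fingroup.
From mathcomp Require Import generic_quotient.
From mathcomp Require Import all_classical all_reals all_analysis.
From mathcomp Require Import lra zify.
(** The gluing of the top side to the bottom side is the dyadic odometer [T], and
    the van der Corput sequence is its orbit of 0: [a_(n+1) = T a_n].  Shift the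
    sequence by a small [eps > 0] to avoid the singular points, and place vertex
    [n] at [(a_n + eps, 1/4)].  The edges of [C_1] are vertical: leaving [n]
    upwards one crosses the top side and reenters below [n + 1].  The edges of
    [C_pi] are pieces of the horizontal line at height [1/4], except the last one,
    which leaves through [(1, 1/4)], reenters at [(0, 3/4)], and descends to the
    leftmost vertex through a strip to its left that meets no other edge. *)

Set Implicit Arguments.
Unset Strict Implicit.
Unset Printing Implicit Defensive.
Import Order.TTheory GRing.Theory Num.Theory.
Import numFieldNormedType.Exports.
Local Open Scope classical_set_scope.
Local Open Scope ring_scope.

(** * The dyadic segments of the sides and the translations between them *)

Section Segments.
Variable R : realType.
Implicit Types (x y : R) (j k n : nat).

Lemma seg_endE k : seg_end R k = 1 - 2 ^- k.
Proof.
elim: k => [|k IH]; first by rewrite /seg_end big_geq // expr0 invr1 subrr.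
rewrite /seg_end big_nat_recr//= -/(seg_end R k) IH.
by rewrite exprS invfM; lra.
Qed.

Lemma exp2V_le j k : (j <= k)%N -> (2 ^- k : R) <= 2 ^- j.
Proof. by move=> jk; rewrite lef_pV2 ?posrE ?exprn_gt0// ler_eXn2l// ltr1n. Qed.

Lemma exp2VS k : (2 ^- k.+1 : R) = 2 ^- k / 2.
Proof. by rewrite exprSr invfM. Qed.

Definition inner k x := seg_end R k.-1 < x < seg_end R k.

Lemma inner01 k x : inner k x -> 0 < x < 1.
Proof.
rewrite /inner !seg_endE => /andP[h1 h2].
have := @exp2V_le 0 k.-1 isT; rewrite expr0 invr1.
have : (0 : R) < 2 ^- k by rewrite invr_gt0 exprn_gt0.
lra.
Qed.

Lemma inner_seg_end k j x : (0 < k)%N -> inner k x -> x != seg_end R j.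
Proof.
case: k => // k _; rewrite /inner !seg_endE /= => /andP[h1 h2].
apply/eqP => xE; have [jk|kj] := leqP j k.
  by have := exp2V_le jk; lra.
by have := exp2V_le kj; lra.
Qed.

Lemma inner_uniq k j x : (0 < k)%N -> (0 < j)%N -> inner k x ->
  seg_end R j.-1 <= x <= seg_end R j -> j = k.
Proof.
case: k j => [|k] [|j]// _ _; rewrite /inner !seg_endE /=.
move=> /andP[h1 h2] /andP[h3 h4]; congr S; apply/eqP; rewrite eqn_leq.
apply/andP; split; rewrite leqNgt; apply/negP => jk.
  by have := exp2V_le jk; lra.
by have := exp2V_le jk; lra.
Qed.

(* Reflecting the bottom segments by [y |-> 1 - y] turns them into the top
   segments, so facts about the top side transfer to the bottom side. *)
Lemma seg_translate_inner k x y : (0 < k)%N -> inner k x ->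
  seg_translate k x y -> inner k (1 - y).
Proof.
case: k => // k _; rewrite /inner /seg_translate !seg_endE /= exp2VS.
by move=> h [_ ->]; lra.
Qed.

Lemma seg_translate_itv k x y : (0 < k)%N -> seg_translate k x y ->
  seg_end R k.-1 <= 1 - y <= seg_end R k.
Proof.
case: k => // k _; rewrite /seg_translate !seg_endE /= exp2VS.
by move=> [h ->]; lra.
Qed.

End Segments.

(** * Gluing classes of points away from the singularities *)

Section GoodRepresentatives.
Variable R : realType.
Notation square := (set_type (@unit_square R)).
Implicit Types (z w : square).

Definition in_segment (x : R) := exists2 k, (0 < k)%N & inner k x.

(* Normal forms for the quotient: the left and bottom sides are excluded, so a
   class contains at most one good point and equality can be tested on it. *)
Definition good (z : R * R) :=
  [/\ 0 < z.1 <= 1, 0 < z.2 <= 1, z.2 = 1 -> in_segment z.1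
    & z.1 = 1 -> in_segment z.2].

Lemma in_segment01 x : in_segment x -> 0 < x < 1.
Proof. by move=> [k _]; exact: inner01. Qed.

(** By uniqueness of the segment, the index of the gluing is that of the open segment holding the
    good point; hence its partner is interior to a bottom or left segment. *)
Lemma good_gluedE z w : good (val z) -> glued z w ->
  exists2 y : R, in_segment (1 - y) & val w = (y, 0) \/ val w = (0, y).
Proof.
case: z w => -[z1 z2] hz [[w1 w2] hw] /= [/= _ _ h3 h4] [k k0 /= kzw].
have key (x y : R) : in_segment x -> seg_translate k x y -> in_segment (1 - y).
  move=> [i i0 ii] kx; have ki : k = i := inner_uniq i0 k0 ii kx.1; subst i.
  by exists k => //; exact: seg_translate_inner kx.
case: kzw => -[/= e1 -> kxy].
  by exists w1; [exact: key (h3 e1) kxy|left].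
by exists w2; [exact: key (h4 e1) kxy|right].
Qed.

(** The partner is interior to its segment, so it determines the side and the index of the gluing,
    and a translation is injective. *)
Lemma good_glued_inj z w u : good (val z) -> glued z w -> glued u w -> u = z.
Proof.
move=> gz zw; have [y iy wE] := good_gluedE gz zw; have y01 := in_segment01 iy.
case: z w u wE gz zw => -[z1 z2] hz [[w1 w2] hw] [[u1 u2] hu] /= wE [/= _ _ h3 h4].
move=> [j j0 hj] [k k0 hk]; apply: val_inj => /=.
have key (x x' v : R) : in_segment x -> seg_translate j x v ->
    seg_translate k x' v -> x' = x.
  move=> [i i0 ii] jx kx; have ij : j = i := inner_uniq i0 j0 ii jx.1; subst i.
  have iv := seg_translate_inner j0 ii jx.
  have := inner_uniq j0 k0 iv (seg_translate_itv k0 kx) => kj; subst k.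
  by case: jx kx => [_ ->] [_]; lra.
case: hj hk => -[/= e1 e1' hj] [] [/= e2 e2' hk].
- by rewrite (key _ _ _ (h3 e1) hj hk) e1 e2.
- by case: wE => -[] *; exfalso; lra.
- by case: wE => -[] *; exfalso; lra.
- by rewrite (key _ _ _ (h4 e1) hj hk) e1 e2.
Qed.

(** Nothing is glued to a good point from the top or right side, and its partners lie on the bottom
    or left side off the corners, from where [glued] leads no further and goes back only to [z]. One
    step thus exhausts the class. *)
Lemma good_class z w : good (val z) -> clos_refl_sym_trans _ (@glued R) z w ->
  w = z \/ glued z w.
Proof.
move=> gz zw; pose K w := w = z \/ glued z w.
suff Kinv a b : clos_refl_sym_trans _ (@glued R) a b -> K a <-> K b.
  by apply/(Kinv _ _ zw); left.
elim=> {a b} [a b ab|//|a b _ ->//|a b c _ -> _ ->//]; split=> -[e|zc].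
- by subst a; right.
- have [y /in_segment01 y01 aE] := good_gluedE gz zc.
  by case: ab => k k0 [] [+ _ _]; case: aE => -> /= ?; exfalso; lra.
- subst b; case: gz => h1 h2 _ _; case: ab => k k0 [] [_ e _].
    by rewrite e in h2; exfalso; lra.
  by rewrite e in h1; exfalso; lra.
- by left; exact: good_glued_inj zc ab.
Qed.

Lemma pi_eqP z w :
  \pi_(chamanara_quotient R)%qT z = \pi_(chamanara_quotient R)%qT w <->
  clos_refl_sym_trans _ (@glued R) z w.
Proof.
have E := @eqmodP _ (chamanara_equiv R) z w.
by split=> [zw|/asboolP zw]; [apply/asboolP; exact/E|exact: (elimT E)].
Qed.

Lemma good_eq z w : good (val z) -> good (val w) ->
  \pi_(chamanara_quotient R)%qT z = \pi_(chamanara_quotient R)%qT w -> z = w.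
Proof.
move=> gz gw /pi_eqP /(good_class gz) [->//|zw].
have [y _ wE] := good_gluedE gz zw; case: gw => h1 h2 _ _; exfalso.
by case: wE h1 h2 => -> /=; lra.
Qed.

Lemma good_surface z : good (val z) ->
  chamanara_surface (\pi_(chamanara_quotient R)%qT z).
Proof.
move=> gz [w vw] /pi_eqP /(good_class gz) [e|zw].
  rewrite {w}e in vw; case: gz vw => h1 h2 h3 h4.
  case: (val z) h1 h2 h3 h4 => z1 z2 /= h1 h2 h3 h4.
  move=> [[]|[[]|[k [[]|[]|[]|[]]]]] e1 e2; try (exfalso; lra).
  - by have := in_segment01 (h3 e2); lra.
  - by have [i i0 /(inner_seg_end k i0)] := h3 e2; rewrite e1 eqxx.
  - by have [i i0 /(inner_seg_end k i0)] := h4 e1; rewrite e2 eqxx.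
have [y iy wE] := good_gluedE gz zw; have y01 := in_segment01 iy.
have [i i0 /(inner_seg_end _ i0) ne] := iy.
by case: wE vw => -> [[]|[[]|[k [[]|[]|[]|[]]]]] e *; try (exfalso; lra);
  have := ne k; rewrite seg_endE e eqxx.
Qed.

Lemma glued_pi z w : glued z w ->
  \pi_(chamanara_quotient R)%qT z = \pi_(chamanara_quotient R)%qT w.
Proof. by move=> zw; apply/pi_eqP; exact: rst_step. Qed.

End GoodRepresentatives.

(** * Continuous paths in the quotient *)

Section Paths.
Variable R : realType.

Lemma continuous_if_le (T : topologicalType) (f g : R -> T) (c : R) :
  continuous f -> continuous g -> f c = g c ->
  continuous (fun t : R => if (t <= c)%R then f t else g t).
Proof.
move=> cf cg fg; apply/continuous_subspace_setT.
have -> : setT = [set t | t <= c] `|` [set t | c <= t].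
  by apply/seteqP; split=> // t _ /=; case: (leP t c) => [|/ltW]; [left|right].
apply: withinU_continuous; [exact: closed_le|exact: closed_ge| |].
  apply: (subspace_eq_continuous (f := f)); last exact: continuous_subspaceT.
  by move=> t; rewrite inE /from_subspace => /= tc; case: leP => //; rewrite ltNge tc.
apply: (subspace_eq_continuous (f := g)); last exact: continuous_subspaceT.
move=> t; rewrite inE /from_subspace => /= ct; case: leP => // tc.
by have -> : t = c by apply/le_anti/andP.
Qed.

(** Clamping both coordinates retracts the plane onto the square, so that a ray projects to a path
    defined and continuous on all of [R]. *)
Definition clamp (x : R) : R := Num.min 1 (Num.max 0 x).

Lemma clamp01 x : 0 <= clamp x <= 1.
Proof. by rewrite le_min ler01 le_max ge_min !lexx. Qed.

Lemma clampE x : 0 <= x <= 1 -> clamp x = x.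
Proof. by move=> /andP[x0 x1]; rewrite /clamp max_r// min_r. Qed.

Lemma clamp_square z : (clamp z.1, clamp z.2) \in @unit_square R.
Proof. by rewrite inE; split; exact: clamp01. Qed.

Definition retract z : set_type (@unit_square R) := SigSub (clamp_square z).

Lemma retractK z : unit_square z -> val (retract z) = z.
Proof. by case: z => x y [hx hy] /=; rewrite !clampE. Qed.

Definition ray (z v : R * R) (t : R) : R * R := (z.1 + t * v.1, z.2 + t * v.2).

Lemma continuous_retract_ray z v :
  continuous (fun t => \pi_(chamanara_quotient R)%qT (retract (ray z v t))).
Proof.
move=> t; apply: continuous_comp; last exact: pi_continuous.
apply: (@continuous_comp_initial _ _ _ (val : set_type (@unit_square R) -> R * R)) => {}t.
have cl (a b : R) : {for t, continuous (fun t : R => clamp (a + t * b))}.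
  apply: continuous_min; first exact: cvg_cst.
  apply: continuous_max; first exact: cvg_cst.
  by apply: cvgD; [exact: cvg_cst|apply: cvgM; [exact: cvg_id|exact: cvg_cst]].
exact: (cvg_pair (cl z.1 v.1) (cl z.2 v.2)).
Qed.

End Paths.

(** * The van der Corput sequence as an odometer orbit *)

Section VanDerCorput.
Variable R : realType.
Notation vdc := (@vdc R).

(** The lowest binary digit of [n] becomes the leading binary digit of [vdc n]. *)
Lemma vdc_half n : vdc n = ((n %% 2)%:R + vdc (n %/ 2)) / 2.
Proof.
have nn : (n < 2 ^ n)%N by exact: ltn_expl.
have hn : (n %/ 2 < 2 ^ n)%N by rewrite (leq_ltn_trans _ nn)// leq_div.
rewrite (vdcE R hn) (@vdcE R n.+1 n); last first.
  by rewrite (ltn_trans nn)// ltn_exp2l.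
rewrite big_ord_recl /= /bdigit expn0 divn1 expr1 mulrDl mulr_suml.
congr (_ + _); apply: eq_bigr => k _ /=.
by rewrite /bump /= add1n expnS divnMA [2 ^+ k.+2]exprSr invfM mulrA.
Qed.

Lemma vdc_even n : vdc n.*2 = vdc n / 2.
Proof. by rewrite vdc_half -muln2 modnMl mulnK// add0r. Qed.

Lemma vdc_odd n : vdc n.*2.+1 = (1 + vdc n) / 2.
Proof.
by rewrite vdc_half -addn1 -muln2 modnMDl divnMDl// addn0.
Qed.

Lemma half_ltn L n : (n < 2 ^ L.+1)%N -> (n./2 < 2 ^ L)%N.
Proof. by rewrite expnS; lia. Qed.

Lemma vdc_itv L n : (n < 2 ^ L)%N -> 0 <= vdc n <= 1 - 2 ^- L.
Proof.
elim: L n => [|L IH] n.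
  rewrite ltnS leqn0 => /eqP ->.
  by rewrite (@vdcE R 0)// big_ord0 expr0 invr1 subrr lexx.
move=> /half_ltn /IH h; rewrite -(odd_double_half n) exp2VS.
by case: (odd n); rewrite ?add0n ?add1n ?vdc_even ?vdc_odd; lra.
Qed.

(* The van der Corput sequence is the orbit of 0 under the dyadic odometer,
   which is the translation gluing the top side to the bottom side. *)
Lemma vdcS L n : (n.+1 < 2 ^ L)%N ->
  exists2 k, (0 < k)%N & seg_end R k.-1 <= vdc n <= seg_end R k - 2 ^- L /\
    vdc n.+1 = vdc n - seg_end R k.-1 + 2 ^- k.
Proof.
elim: L n => [//|L IH] n nL; rewrite -(odd_double_half n).
(* For odd [n] the carry passes to [n./2], and the map sending [x] to [(1 + x) / 2] takes each top
   segment to the next. For even [n] there is no carry: the first segment moves by 1/2. *)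
case: (boolP (odd n)) => on; rewrite ?add0n ?add1n -?doubleS vdc_odd vdc_even.
  have /IH [[//|k] _ /= [h1 h2]] : (n./2.+1 < 2 ^ L)%N.
    by move: nL; rewrite expnS; lia.
  exists k.+2 => //=; move: h1 h2.
  by rewrite !seg_endE !exp2VS; lra.
have /vdc_itv h : (n./2 < 2 ^ L)%N by apply: half_ltn; exact: ltnW.
by exists 1%N => //=; rewrite !seg_endE !exp2VS expr0 invr1; lra.
Qed.

End VanDerCorput.

(** * The drawing in the plane and its projection to the surface *)

Section Drawing.
Variables (R : realType) (N : nat) (p : {perm 'I_N}) (x : 'I_N -> R).
Hypothesis x01 : forall i, 0 < x i < 1.
Hypothesis xp : forall i j : 'I_N, (i < j)%N -> x (p i) < x (p j).
Hypothesis xS : forall i : 'I_N, (i.+1 < N)%N ->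
  exists2 k, (0 < k)%N & inner k (x i) /\ seg_translate k (x i) (x (ordS i)).

Implicit Types (i j : 'I_N) (s t : R).

Let xp_le i j : (i <= j)%N -> x (p i) <= x (p j).
Proof. by rewrite leq_eqVlt => /predU1P[/val_inj->//|/xp/ltW]. Qed.

Let x_inj : injective x.
Proof.
move=> i j; rewrite -(permKV p i) -(permKV p j).
move: (p^-1 i)%g (p^-1 j)%g => {}i {}j ij; congr (p _); apply: val_inj => /=.
by case: (ltngtP i j) => // /xp; rewrite ij ltxx.
Qed.

Let ordS_lt i : (i.+1 < N)%N -> ordS i = i.+1 :> nat.
Proof. by move=> iN; rewrite /= modn_small. Qed.

Let ordS_eq i : (N <= i.+1)%N -> ordS i = 0%N :> nat.
Proof.
by move=> Ni; rewrite /= (_ : i.+1 = N) ?modnn//; apply/eqP; rewrite eqn_leq Ni ltn_ord.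
Qed.

Definition place i : R * R := (x i, 1 / 4).

(* Edges are parametrized so that they cross the sides of the square at time
   1/2. *)
Definition half1 (e : 'I_N + 'I_N) : R -> R * R :=
  match e with
  | inl i => ray (place i) (0, 3 / 2)
  | inr i => if (i.+1 < N)%N then ray (place (p i)) (x (p (ordS i)) - x (p i), 0)
             else ray (place (p i)) (2 * (1 - x (p i)), 0)
  end.

(** The base points are extrapolated back to time 0: the rays are on the bottom or left side at time
    1/2 and at the end vertex at time 1. *)
Definition half2 (e : 'I_N + 'I_N) : R -> R * R :=
  match e with
  | inl i => ray (x (ordS i), - (1 / 4)) (0, 1 / 2)
  | inr i => if (i.+1 < N)%N then ray (place (p i)) (x (p (ordS i)) - x (p i), 0)
             else ray (- x (p (ordS i)), 5 / 4) (2 * x (p (ordS i)), - 1)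
  end.

(** At time 1/2 the point on the top or right side is chosen, since it is the good one of the glued
    pair. *)
Definition lift e (t : R) := if (t <= 1 / 2)%R then half1 e t else half2 e t.

Definition drawn (e : 'I_N + 'I_N) := if e is inl i then (i.+1 < N)%N else true.

Let lerp_lt (a b t : R) : a < b -> 0 < t < 1 -> a < a + t * (b - a) < b.
Proof.
move=> ab /andP[t0 t1].
have : 0 < t * (b - a) by rewrite mulr_gt0// subr_gt0.
have : 0 < (1 - t) * (b - a) by rewrite mulr_gt0// subr_gt0.
lra.
Qed.

Lemma lift_inl i t : 0 < t < 1 ->
  (lift (inl i) t).1 = x i /\ 1 / 4 < (lift (inl i) t).2 \/
  (lift (inl i) t).1 = x (ordS i) /\ (lift (inl i) t).2 < 1 / 4.
Proof.
move=> t01; rewrite /lift; case: (leP t) => /= tc; [left|right].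
  by rewrite mulr0 addr0; split=> //; lra.
by rewrite mulr0 addr0; split=> //; lra.
Qed.

(** The second alternative is the descent of the last edge in the strip left of all vertices. The
    bounds range over all [j] so that arcs of different index compare directly. *)
Lemma lift_inr i t : 0 < t < 1 ->
  [/\ (lift (inr i) t).2 = 1 / 4,
      forall j, (j <= i)%N -> x (p j) < (lift (inr i) t).1 &
      forall j, (i < j)%N -> (lift (inr i) t).1 < x (p j)] \/
  [/\ i.+1 = N, 1 / 4 < (lift (inr i) t).2 &
      forall j, (lift (inr i) t).1 < x j].
Proof.
move=> t01; have [iN|Ni] := ltnP i.+1 N.
  left; have -> : lift (inr i) t = ray (place (p i)) (x (p (ordS i)) - x (p i), 0) t.
    by rewrite /lift /= iN; case: ifP.
  rewrite /= mulr0 addr0; have /xp h : (i < ordS i)%N by rewrite ordS_lt.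
  have /andP[h1 h2] := lerp_lt h t01; split=> // j ij.
    by rewrite (le_lt_trans _ h1)// xp_le.
  by rewrite (lt_le_trans h2)// xp_le// ordS_lt.
have iN : i.+1 = N by apply/eqP; rewrite eqn_leq Ni ltn_ord.
have x1 := x01 (p i); have x0 := x01 (p (ordS i)).
rewrite /lift /= ltnNge Ni /=; case: (leP t) => tc; [left|right]; split=> //=; try lra.
- move=> j /xp_le ij; rewrite (le_lt_trans ij)// ltrDl.
  by rewrite mulr_gt0//; lra.
- by move=> j; rewrite -ltnS iN ltnNge ltn_ord.
- move=> j; have : x (p (ordS i)) <= x j by rewrite -(permKV p j) xp_le// ordS_eq.
  have : 0 < (1 - t) * x (p (ordS i)) by rewrite mulr_gt0//; lra.
  lra.
Qed.

Lemma lift_place e i t : 0 < t < 1 -> lift e t <> place i.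
Proof.
move=> t01 E; have e1 : (lift e t).1 = x i by rewrite E.
have e2 : (lift e t).2 = 1 / 4 by rewrite E.
case: e {E} e1 e2 => j e1 e2; first by have [] := lift_inl j t01; lra.
have [[_ h1 h2]|[_ h _]] := lift_inr j t01; last by lra.
rewrite -(permKV p i) in e1; have [ij|ij] := leqP ((p^-1)%g i) j.
  by have := h1 _ ij; rewrite e1 ltxx.
by have := h2 _ ij; rewrite e1 ltxx.
Qed.

Let lift_inl_inr i j s t : 0 < s < 1 -> 0 < t < 1 ->
  lift (inl i) s <> lift (inr j) t.
Proof.
move=> s01 t01 E; have := lift_inl i s01; have := lift_inr j t01; rewrite -E.
move=> [[-> _ _]|[_ _ h]] [] [h1 h2]; try lra.
  by have := h i; rewrite h1 ltxx.
by have := h (ordS i); rewrite h1 ltxx.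
Qed.

Let lift_inr_lt i j s t : (i < j)%N -> 0 < s < 1 -> 0 < t < 1 ->
  lift (inr i) s <> lift (inr j) t.
Proof.
move=> ij s01 t01 E; have := lift_inr i s01; have := lift_inr j t01; rewrite -E.
move=> [[e h' _]|[jN h' _]] [[e' _ h]|[iN h _]]; try lra; last by lia.
by have := h j ij; have := h' j (leqnn j); lra.
Qed.

(** Vertical arcs are identified by [x i] above height 1/4 and by [x (ordS i)] below it, both
    injective in [i]. *)
Lemma lift_disjoint e f s t : 0 < s < 1 -> 0 < t < 1 ->
  lift e s = lift f t -> e = f.
Proof.
case: e f => i [] j s01 t01 E.
- have := lift_inl i s01; have := lift_inl j t01; rewrite E.
  move=> [] [-> h] [] [/x_inj ij h'].
  + by rewrite ij.
  + by exfalso; lra.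
  + by exfalso; lra.
  + by rewrite (ordS_inj ij).
- by case: (lift_inl_inr s01 t01 E).
- by case: (lift_inl_inr t01 s01 (esym E)).
- congr inr; apply: val_inj; case: (ltngtP i j) => // ij.
    by case: (lift_inr_lt ij s01 t01 E).
  by case: (lift_inr_lt ij t01 s01 (esym E)).
Qed.

Lemma lift_simple e s t : drawn e -> 0 <= s -> s < t -> t <= 1 ->
  lift e s = lift e t -> s = 0 /\ t = 1.
Proof.
have ray_inj (z v : R * R) a b : a < b -> v.1 != 0 \/ v.2 != 0 ->
    ray z v a <> ray z v b.
  move=> ab hv [] /addrI E1 /addrI E2; move: ab; case: hv => hv.
    by rewrite (mulIf hv E1) ltxx.
  by rewrite (mulIf hv E2) ltxx.
move=> + s0 st t1; case: e => i /= iN.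
  rewrite /lift; case: (leP s) => sc; case: (leP t) => tc /=; try lra.
  - by move/ray_inj => []//=; right; apply/eqP; lra.
  - rewrite /ray /= !mulr0 !addr0 => -[/x_inj/(congr1 val)].
    by rewrite /= modn_small//; lia.
  - by move/ray_inj => []//=; right; apply/eqP; lra.
have x1 := x01 (p i); have x0 := x01 (p (ordS i)).
rewrite /lift /=; case: (ltnP i.+1 N) => [{}iN|Ni].
  have /xp h : (i < ordS i)%N by rewrite ordS_lt.
  by rewrite !if_same => /ray_inj []//=; left; apply/eqP; lra.
case: (leP s) => sc; case: (leP t) => tc /=; try lra.
- by move/ray_inj => []//=; left; apply/eqP; lra.
(* Equal abscissae make [x (p i) - x (p (ordS i))], [2 * s * (1 - x (p i))] and
   [2 * (1 - t) * x (p (ordS i))] sum to 0. All are nonnegative, so each vanishes; this is the loop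
   of the case [N = 1]. *)
- move=> -[E _].
  have le0 : x (p (ordS i)) <= x (p i) by rewrite xp_le// ordS_eq.
  have h1 : 0 <= s * (1 - x (p i)) by rewrite mulr_ge0//; lra.
  have h2 : 0 <= (1 - t) * x (p (ordS i)) by rewrite mulr_ge0//; lra.
  have /eqP : s * (1 - x (p i)) = 0 by lra.
  have /eqP : (1 - t) * x (p (ordS i)) = 0 by lra.
  by rewrite !mulf_eq0 => /orP[] /eqP ? /orP[] /eqP ?; lra.
- by move/ray_inj => []//=; left; apply/eqP; lra.
Qed.

(** The last edge of [C_pi] crosses the right side at this height; the fact is taken from the
    context in [lift_good]. *)
Let quarter_inner : in_segment (1 / 4 : R).
Proof.
by exists 1%N => //; rewrite /inner /= !seg_endE expr0 expr1 invr1; lra.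
Qed.

Lemma place_good i : good (place i).
Proof. by have := x01 i; split=> //=; lra. Qed.

Lemma lift_good e t : drawn e -> 0 <= t <= 1 -> good (lift e t).
Proof.
case: e => i /= iN t01.
  have xi := x01 i; have xi' := x01 (ordS i); have [k k0 [ik _]] := xS iN.
  rewrite /lift; case: (leP t) => tc /=; split=> /=; rewrite ?mulr0 ?addr0; try lra.
  by exists k.
have x1 := x01 (p i); have x0 := x01 (p (ordS i)).
rewrite /lift /=; case: (ltnP i.+1 N) => [{}iN|Ni].
  have /xp h : (i < ordS i)%N by rewrite ordS_lt.
  have h1 : 0 <= t * (x (p (ordS i)) - x (p i)) by rewrite mulr_ge0//; lra.
  have h2 : 0 <= (1 - t) * (x (p (ordS i)) - x (p i)) by rewrite mulr_ge0//; lra.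
  by rewrite if_same; split=> /=; rewrite ?mulr0 ?addr0; lra.
case: (leP t) => tc /=.
  have h1 : 0 <= t * (1 - x (p i)) by rewrite mulr_ge0//; lra.
  have h2 : 0 <= (1 - 2 * t) * (1 - x (p i)) by rewrite mulr_ge0//; lra.
  by split=> /=; rewrite ?mulr0 ?addr0 //; lra.
have h1 : 0 < (2 * t - 1) * x (p (ordS i)) by rewrite mulr_gt0//; lra.
have h2 : 0 <= (1 - t) * x (p (ordS i)) by rewrite mulr_ge0//; lra.
by split=> /=; lra.
Qed.

Lemma good_square z : good z -> @unit_square R z.
Proof. by case=> /andP[/ltW ? ?] /andP[/ltW ? ?] _ _; split; apply/andP. Qed.

Notation proj z := (\pi_(chamanara_quotient R)%qT (retract z)).

Lemma good_proj_inj z w : good z -> good w -> proj z = proj w -> z = w.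
Proof.
move=> gz gw /good_eq; rewrite !retractK; try exact: good_square.
by move=> /(_ gz gw) /(congr1 val); rewrite !retractK//; exact: good_square.
Qed.

Lemma good_proj_surface z : good z -> chamanara_surface (proj z).
Proof. by move=> gz; apply: good_surface; rewrite retractK//; exact: good_square. Qed.

Lemma halves_glued e : drawn e -> proj (half1 e (1 / 2)) = proj (half2 e (1 / 2)).
Proof.
case: e => i /= iN.
  have [k k0 [_ ik]] := xS iN; have := x01 i; have := x01 (ordS i) => ? ?.
  apply: glued_pi; exists k => //; left.
  rewrite !retractK /=; try (split; rewrite /= ?mulr0 ?addr0; lra).
  by rewrite !mulr0 !addr0; split=> //; lra.
case: ifPn => // _; have x1 := x01 (p i); have x0 := x01 (p (ordS i)).
(* The first right segment, from 0 to 1/2, is glued to the left one from 1/2 to 1, taking height 1/4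
   to 3/4. *)
apply: glued_pi; exists 1%N => //; right.
rewrite !retractK /=; try (split=> /=; lra).
split; try lra.
by rewrite /seg_translate /= !seg_endE expr0 expr1 invr1; lra.
Qed.

Lemma continuous_lift e : drawn e -> continuous (fun t => proj (lift e t)).
Proof.
move=> de.
have -> : (fun t => proj (lift e t)) =
    (fun t => if (t <= 1 / 2)%R then proj (half1 e t) else proj (half2 e t)).
  by apply/funext => t; rewrite /lift; case: ifP.
apply: continuous_if_le; last exact: halves_glued.
  by case: e {de} => i /=; [|case: ifP => _]; exact: continuous_retract_ray.
by case: e {de} => i /=; [|case: ifP => _]; exact: continuous_retract_ray.
Qed.

Lemma lift0 e : lift e 0 = place (@ends (sequence_graph p) e).1.
Proof.
rewrite /lift ifT; last by lra.
by case: e => i /=; [|case: ifP => _]; rewrite /ray /= !mul0r !addr0.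
Qed.

Lemma lift1 e : lift e 1 = place (@ends (sequence_graph p) e).2.
Proof.
rewrite /lift ifN; last by rewrite -ltNge; lra.
by case: e => i /=; [|case: ifP => _]; rewrite /ray /place /=; congr (_, _); lra.
Qed.

(** All lifts consist of good points, on which the projection is injective, so every clause about
    crossings reduces to the plane. *)
Lemma odometer_drawing (hN : (0 < N)%N) :
  @embeds_in R (delete_edge (C1_closing_edge hN p)) (chamanara_quotient R)
    (@chamanara_surface R).
Proof.
exists (fun i => proj (place i)), (fun e t => proj (lift (val e) t)).
have de (e : edge (delete_edge (C1_closing_edge hN p))) : drawn (val e).
  case: e => -[i|//] /= ne; have := ltn_ord i; rewrite leq_eqVlt => /orP[/eqP iN|//].
  by case/eqP: ne; congr inl; apply: val_inj; exact: (congr1 predn iN).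
have le01 (t : R) : 0 < t < 1 -> 0 <= t <= 1 by lra.
split.
- split=> [i j /good_proj_inj|i]; last exact/good_proj_surface/place_good.
  by move=> /(_ (place_good i) (place_good j)) [/x_inj].
- move=> e; split; last 2 first.
  + by rewrite lift0.
  + by rewrite lift1.
  + by apply: continuous_subspaceT; exact: continuous_lift.
  + by move=> t t01; apply: good_proj_surface; exact: lift_good.
- move=> e s t s0 st t1 /good_proj_inj E; apply: (lift_simple (de e)) => //.
  by apply: E; apply: lift_good => //; lra.
- move=> e i t t01 /good_proj_inj E; apply: (@lift_place (val e) i t) => //.
  by apply: E; [apply: lift_good => //; lra|exact: place_good].
- move=> e f s t ef s01 t01 /good_proj_inj E; apply/ef/val_inj.
  by apply: (@lift_disjoint _ _ s t) => //; apply: E; apply: lift_good => //; lra.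
Qed.

End Drawing.

(** * The shifted van der Corput sequence *)

Theorem theorem1p4 (R : realType) (N : nat) (hN : (1 <= N)%N)
    (hN4 : forall m : nat, N <> (4 ^ m)%N)
    (p : {perm 'I_N}) (hp : sorts_prefix (@vdc R) p) :
  @embeds_in R (delete_edge (C1_closing_edge hN p)) (chamanara_quotient R)
    (@chamanara_surface R).
Proof.
have e0 : 0 < (2 ^- N : R) by rewrite invr_gt0 exprn_gt0.
have N2 : (N < 2 ^ N)%N by exact: ltn_expl.
(* By [vdcS], a term with a successor below [2 ^ N] stays at least [2 ^- N] from the right end of
   its segment. A shift by half of that moves it into the open segment and commutes with the gluing
   translation. *)
apply: (@odometer_drawing R N p (fun i => vdc R i + 2 ^- N / 2)).
- move=> i; have /(@vdc_itv R) : (i < 2 ^ N)%N by exact: ltn_trans N2.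
  lra.
- by move=> i j /hp; lra.
- move=> i iN; have [k k0 [h1 h2]] := vdcS R (ltn_trans iN N2).
  by exists k; rewrite // /inner /seg_translate /= modn_small// h2; split; [|split]; lra.
Qed.
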